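(* Let $X$ be a real Banach space with $\dim X\ge 2$. For every $f\in\mathscr{C}(X)$: $f$ belongs to $\mathscr{A}$ if and only if there exists a unique $u\in X^*$ such that $h_{u,\alpha}\in A(f)$ for some $\alpha\in\mathbb{R}$.
   Context: $X^*$ is the topological dual of $X$ and $\langle u,x\rangle=u(x)$. $\mathscr{C}(X)$ is the set of proper (not identically $+\infty$), convex, (norm) lower semicontinuous functions $f:X\to\mathbb{R}\cup\{+\infty\}$, ordered pointwise. For $(u,\alpha)\in X^*\times\mathbb{R}$, $h_{u,\alpha}:X\to\mathbb{R}$ is $h_{u,\alpha}(x)=\langle u,x\rangle+\alpha$, and $\mathscr{A}=\{h_{u,\alpha}:(u,\alpha)\in X^*\times\mathbb{R}\}\subset\mathscr{C}(X)$ is the set of continuous affine functions on $X$. For $f\in\mathscr{C}(X)$, $A(f)=\{h\in\mathscr{A}: h\le f\}$. *)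

(* Defs.v *)
From HB Require Import structures.
From mathcomp Require Import all_boot all_order all_algebra.
From mathcomp Require Import all_classical all_reals all_analysis.

Set Implicit Arguments.
Unset Strict Implicit.
Unset Printing Implicit Defensive.

Import Order.TTheory GRing.Theory Num.Theory.
Import numFieldNormedType.Exports.

Local Open Scope classical_set_scope.
Local Open Scope ring_scope.

Section Defs.
Context {R : realType}.

(* [dim X >= n], for [X] possibly infinite-dimensional: [X] contains [n]
   linearly independent vectors. *)
Definition dim_ge (X : lmodType R) (n : nat) : Prop :=
  exists e : 'I_n -> X, forall c : 'I_n -> R,
    \sum_(i < n) c i *: e i = 0 -> forall i, c i = 0.

Context {X : normedModType R}.

(* The topological dual, as a set of functions: equality of functionals is
   equality of functions. *)
Definition dual : set (X -> R^o) := [set u | linear u /\ continuous u].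

(* Excluding the value [-oo] renders the codomain [R \cup {+oo}]. The
   convention [0 * +oo = 0] in [\bar R] makes the endpoints [t = 0, 1] of the
   convexity inequality read [f y <= f y] and [f x <= f x]. *)
Definition convex_ereal (f : X -> \bar R) : Prop :=
  forall (x y : X) (t : R), 0 <= t <= 1 ->
    (f (t *: x + (1 - t) *: y)%R <= t%:E * f x + (1 - t)%:E * f y)%E.

Definition proper_convex_lsc : set (X -> \bar R) :=
  [set f | [/\ forall x, f x <> -oo%E,
               exists x, f x <> +oo%E,
               convex_ereal f
             & lower_semicontinuous f]].

Definition affine_fun (u : X -> R^o) (alpha : R) : X -> \bar R :=
  fun x => (u x + alpha)%:E.

Definition continuous_affine : set (X -> \bar R) :=
  [set h | exists u alpha, dual u /\ h = affine_fun u alpha].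

Definition affine_minorants (f : X -> \bar R) : set (X -> \bar R) :=
  [set h | continuous_affine h /\ forall x, (h x <= f x)%E].

End Defs.
Arguments dual {R} X.
Arguments proper_convex_lsc {R} X.
Arguments continuous_affine {R} X.

(* Main.v *)
(** The infimal convolution of [f] with [k * `|_|], for [k] large, is a real
    convex function below [f] whose value at a given [x] exceeds any prescribed
    [c < f x]. A subgradient of it at [x], given by the Hahn-Banach theorem, is
    the slope [v] of a minorant of [f], with [v (z - x) + c <= f z] for every
    [z]. If [u] is the only slope then [v = u], and letting [c] tend to [f x]
    gives [f x - u x <= f z - u z] for all [x] and [z], so [f - u] is constant.
    Conversely, a minorant of slope [v] of an affine function of slope [u] bounds
    the linear form [v - u] above, so [v = u]. *)
Require Import Defs.
From HB Require Import structures.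
From mathcomp Require Import all_boot all_order all_algebra.
From mathcomp Require Import all_classical all_reals all_analysis.
From mathcomp Require Import ring lra.

Import Order.TTheory GRing.Theory Num.Theory.
Import numFieldNormedType.Exports.

Local Open Scope classical_set_scope.
Local Open Scope ring_scope.

Lemma scaled_bounded_eq0 (R : realFieldType) (s M : R) :
  (forall t, t * s <= M) -> s = 0.
Proof.
move=> sM; apply/eqP/negPn/negP => s0.
have := sM ((M + 1) / s); rewrite divfK //; lra.
Qed.

Section HahnBanach.
Variables (R : realType) (V : lmodType R) (E : V -> R -> Prop).
Hypothesis convexE : forall x y r s t, 0 <= t <= 1 -> E x r -> E y s ->
  E (t *: x + (1 - t) *: y) (t * r + (1 - t) * s).
Hypothesis totalE : forall x, exists r, E x r.
Hypothesis E0_ge0 : forall r, E 0 r -> 0 <= r.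

(** A partial functional is encoded by its graph, so that Zorn's lemma applies to inclusion.
    Single-valuedness is not demanded: it follows from lying below [E]. *)
Definition linear_graph_below (G : set (V * R)) :=
  (forall a x y r s, G (x, r) -> G (y, s) -> G (a *: x + y, a * r + s)) /\
  (forall x r s, G (x, r) -> E x s -> r <= s).

(* The admissible values at [y] are squeezed between [A] and the slopes
   [(s - r) / t] with [t > 0]; [sup A] is one of them. *)
Lemma linear_graph_below_extend G y :
    linear_graph_below G -> G (0, 0) ->
  exists G', [/\ linear_graph_below G', G `<=` G' & exists c, G' (y, c)].
Proof.
move=> [Glin GE] G0.
pose A := [set c | exists x r s t,
  [/\ 0 < t, G (x, r), E (x - t *: y) s & c = (r - s) / t]].
have Aub x r s t : 0 < t -> G (x, r) -> E (x + t *: y) s ->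
    ubound A ((s - r) / t).
  move=> t0 Gx Ex _ [x' [r' [s' [t' [t'0 Gx' Ex' ->]]]]].
  rewrite ler_pdivrMr // mulrAC ler_pdivlMr //.
  have tt0 : 0 < t + t' by rewrite addr_gt0.
  (* This weight gives [l * t = (1 - l) * t']: the [y] components cancel and the mixture lies over
     the domain of [G]. *)
  pose l := t' / (t + t').
  have l1 : 1 - l = t / (t + t') by rewrite /l; field; rewrite gt_eqF.
  have l01 : 0 <= l <= 1.
    by rewrite -subr_ge0 l1 /l !divr_ge0 // ltW.
  have := convexE _ _ _ _ _ l01 Ex Ex'.
  have -> : l *: (x + t *: y) + (1 - l) *: (x' - t' *: y) =
            l *: x + (((1 - l) *: x' + 0) : V).
    rewrite addr0 scalerDr scalerBr !scalerA addrACA -[RHS]addr0.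
    congr (_ + _); rewrite -scalerBl l1 (_ : _ - _ = 0) ?scale0r //.
    by rewrite /l; field; rewrite gt_eqF.
  move=> /(GE _ _ _ (Glin l _ _ _ _ Gx (Glin (1 - l) _ _ _ _ Gx' G0))).
  rewrite l1 /l addr0 -subr_ge0 => le_mix.
  have := mulr_ge0 (ltW tt0) le_mix.
  rewrite (_ : (t + t') * _ = t' * (s - r) + t * (s' - r')); first lra.
  by field; rewrite gt_eqF.
have [s1 Es1] := totalE (0 + 1 *: y).
have [s2 Es2] := totalE (0 - 1 *: y).
have A0 : A !=set0 by exists ((0 - s2) / 1), 0, 0, s2, 1.
have hubA : has_ubound A.
  by eexists; exact: (Aub 0 0 s1 1 ltr01 G0 Es1).
exists [set z | exists x r t, G (x, r) /\ z = (x + t *: y, r + t * sup A)].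
split.
- split.
  + move=> a _ _ _ _ [x [r [t [Gx [-> ->]]]]] [x' [r' [t' [Gx' [-> ->]]]]].
    exists (a *: x + x'), (a * r + r'), (a * t + t'); split; first exact: Glin.
    congr (_, _); last by ring.
    by rewrite scalerDr scalerA addrACA scalerDl.
  + move=> _ _ s [x [r [t [Gx [-> ->]]]]] Ex.
    (* For [t < 0], [sup A] is an upper bound of [A]; for [t > 0], it is the least one. *)
    have [t0|t0|t0] := ltgtP t 0.
    * have : A ((r - s) / - t).
        by exists x, r, s, (- t); rewrite oppr_gt0 scaleNr opprK.
      move=> /(ub_le_sup hubA); rewrite ler_pdivrMr ?oppr_gt0 //; lra.
    * have := ge_sup A0 (Aub _ _ _ _ t0 Gx Ex).
      rewrite ler_pdivlMr //; lra.
    * move: Ex; rewrite t0 scale0r mul0r !addr0; exact: GE Gx.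
- by move=> [x r] Gx; exists x, r, 0; rewrite scale0r mul0r !addr0.
- by exists (sup A), 0, 0, 1; rewrite scale1r mul1r !add0r.
Qed.

Lemma hahn_banach_below :
  exists l : V -> R^o, linear l /\ forall x r, E x r -> l x <= r.
Proof.
have [F FP Ftot|G [[Glin GE] Gmax]] := @Zorn_bigcup _ linear_graph_below.
  split=> [a x y r s [G FG Gx] [G' FG' Gy]|x r s [G FG Gx]].
    have [le|le] := Ftot _ _ FG FG'.
      by exists G' => //; apply: (FP _ FG').1 => //; exact: le.
    by exists G => //; apply: (FP _ FG).1 => //; exact: le.
  exact: (FP _ FG).2 Gx.
(* The empty graph also qualifies for Zorn's lemma; maximality excludes it, since [E0_ge0] puts the
   graph [{(0, 0)}] below [E]. *)
have G00 : G (0, 0).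
  have [[[x r] Gx]|/forallNP Gempty] := pselect (exists z, G z).
    by have := Glin (- 1) _ _ _ _ Gx Gx; rewrite scaleN1r mulN1r !addNr.
  exfalso; apply: (Gmax [set (0, 0)]).
    by split=> [z /Gempty //|/(_ _ erefl)/Gempty].
  split=> [a _ _ _ _ [-> ->] [-> ->]|_ _ s [-> ->] /E0_ge0 //].
  by rewrite scaler0 mulr0 !addr0.
have Gtot x : exists r, G (x, r).
  have [G' [G'P GG' [c G'x]]] := linear_graph_below_extend _ x (conj Glin GE) G00.
  apply: contrapT => /forallNP nGx; apply: (Gmax G') => //.
  by split=> // /(_ _ G'x) /nGx.
(* All multiples of [(0, s - r)] lie in [G], and a single value of [E] over [0] bounds them. *)
have Gfun x r s : G (x, r) -> G (x, s) -> r = s.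
  move=> Gr Gs; have := Glin (- 1) _ _ _ _ Gr Gs.
  rewrite scaleN1r addNr mulN1r => G0; have [M EM] := totalE 0.
  suff : - r + s = 0 by lra.
  apply: (@scaled_bounded_eq0 _ _ M) => t.
  have := Glin t _ _ _ _ G0 G00; rewrite scaler0 !addr0 => Gt.
  exact: GE Gt EM.
have [l Gl] := choice Gtot.
exists l; split=> [a x y|x r]; last exact: GE.
by apply: Gfun (Gl _) _; exact: Glin.
Qed.

End HahnBanach.

Lemma fin_value_of_le (R : numDomainType) (a : \bar R) (r : R) :
  a <> -oo%E -> (a <= r%:E)%E -> exists2 s, a = s%:E & s <= r.
Proof.
by case: a => [s _| // |//]; rewrite lee_fin => sr; exists s.
Qed.

Lemma ereal_le_of_lower_reals (R : realFieldType) (a : \bar R) (b : R) :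
  (forall c, (c%:E < a)%E -> c <= b) -> (a <= b%:E)%E.
Proof.
case: a => [s| |] lec; last by rewrite leNye.
  rewrite lee_fin leNgt; apply/negP => bs.
  have := lec ((s + b) / 2); rewrite lte_fin; lra.
by exfalso; have := lec (b + 1); rewrite ltry => /(_ isT); lra.
Qed.

(** Used at [x] and at [- x], the one-sided bound makes [u] bounded on balls. *)
Lemma dual_of_linear_le (R : realType) (X : normedModType R) (u : X -> R^o)
    (k M : R) : linear u -> (forall x, u x <= k * `|x| + M) -> dual X u.
Proof.
move=> ulin uM; split => //.
pose uL := GRing.isLinear.Build R X R^o *:%R u ulin.
pose U : {linear X -> R^o} := HB.pack u uL.
change (continuous U); apply/linear_bounded_continuous/bounded_funP => r.
exists (`|k| * r + M) => x xr.
have bnd y : `|y| <= r -> U y <= `|k| * r + M.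
  move=> yr; rewrite (le_trans (uM y)) // lerD2r.
  by rewrite (le_trans (ler_wpM2r _ (ler_norm k))) // ler_wpM2l.
by rewrite ler_norml lerNl -linearN !bnd // normrN.
Qed.

(* [E] is the epigraph of [d |-> inf_z (f z + k * `|x + d - z|) - c]; using [E]
   avoids the infimum. The slope [k] is chosen so that the infimum at [d = 0] is
   nonnegative: lower semicontinuity handles [z] near [x], and the given minorant
   handles the other [z]. *)
Lemma affine_minorant_near_value (R : realType) (X : normedModType R)
    (f : X -> \bar R) (u : X -> R^o) (alpha : R) (x : X) (c : R) :
  proper_convex_lsc X f -> dual X u ->
  (forall y, ((u y + alpha)%:E <= f y)%E) -> (c%:E < f x)%E ->
  exists v, dual X v /\ forall z, ((v (z - x) + c)%:E <= f z)%E.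
Proof.
move=> [fNy [z0 fz0] fconv flsc] [ulin ucont] uf cfx.
pose uL := GRing.isLinear.Build R X R^o *:%R u ulin.
pose U : {linear X -> R^o} := HB.pack u uL.
have [K K0 uK] : exists2 k, k > 0 & forall y, `|U y| <= k * `|y|.
  exact: linear_lipschitz.
have [W xW Wc] := flsc _ _ cfx.
have [e /= e0 eW] := (nbhs_ballP _ _).1 xW.
(* [K] pays for the variation of [u]; where [e <= |x - z|], the other summand times [|x - z|] covers
   [c - u x - alpha]. *)
pose k := K + `|c - u x - alpha| / e.
pose E d r := exists z v, (f z <= v%:E)%E /\ r = v + k * `|x + d - z| - c.
have k0 : 0 <= k by rewrite addr_ge0 ?divr_ge0 // ltW.
have fz0E : f z0 = (fine (f z0))%:E.
  by rewrite fineK // fin_numE; apply/andP; split; apply/eqP.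
have Ez0 d : E d (fine (f z0) + k * `|x + d - z0| - c).
  by exists z0, (fine (f z0)); rewrite -fz0E.
have [||r [z [v [fzv ->]]]|v [vlin vE]] := @hahn_banach_below R X E.
- move=> d d' _ _ t /andP[t0 t1] [z [v [fzv ->]]] [z' [v' [fzv' ->]]].
  have [w fz wv] := fin_value_of_le _ _ _ (fNy z) fzv.
  have [w' fz' wv'] := fin_value_of_le _ _ _ (fNy z') fzv'.
  (* [E] asks for an exact value, so the slack [D] of the triangle inequality is moved, times [k],
     into the bound on [f]. *)
  pose D := t * `|x + d - z| + (1 - t) * `|x + d' - z'| -
    `|x + (t *: d + (1 - t) *: d') - (t *: z + (1 - t) *: z')|.
  have D0 : 0 <= D.
    rewrite /D; have -> : x + (t *: d + (1 - t) *: d') - (t *: z + (1 - t) *: z') =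
              t *: (x + d - z) + (1 - t) *: (x + d' - z').
      rewrite !scalerBr !scalerDr [RHS]addrACA -opprD; congr (_ - _).
      by rewrite addrACA -scalerDl subrKC scale1r.
    by rewrite subr_ge0 (le_trans (ler_normD _ _)) // !normrZ !ger0_norm ?subr_ge0.
  exists (t *: z + (1 - t) *: z'), (t * v + (1 - t) * v' + k * D); split.
    have := fconv z z' t; rewrite t0 t1 fz fz' => /(_ isT) /le_trans; apply.
    rewrite -!EFinM -EFinD lee_fin -[leLHS]addr0.
    by rewrite lerD ?mulr_ge0 // lerD // ler_wpM2l // subr_ge0.
  by rewrite /D; ring.
- by move=> d; eexists; exact: Ez0.
- rewrite addr0 subr_ge0; have [xz|xz] := ltP `|x - z| e.
    have /Wc/lt_le_trans /(_ fzv) : W z by apply: eW; rewrite -ball_normE.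
    rewrite lte_fin => /ltW cv; apply: (le_trans cv).
    by rewrite lerDl mulr_ge0.
  have /le_trans/(_ fzv) := uf z; rewrite lee_fin => uv.
  have := uK (x - z); rewrite linearB ler_norml => /andP[_].
  rewrite -[U x]/(u x) -[U z]/(u z) => uxz.
  have ck : c - u x - alpha <= `|c - u x - alpha| / e * `|x - z|.
    rewrite (le_trans (ler_norm _)) // -mulrA ler_peMr //.
    by rewrite mulrC ler_pdivlMr // mul1r.
  rewrite /k mulrDl; lra.
- exists v; split.
    (* The single point [z0] of finite value already bounds [v] with growth [k]. *)
    apply: (@dual_of_linear_le _ _ _ k (fine (f z0) + k * `|x - z0| - c)) => //.
    move=> d; rewrite (le_trans (vE _ _ (Ez0 d))) //.
    have := ler_wpM2l k0 (ler_normD d (x - z0)).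
    rewrite mulrDr addrCA addrA; lra.
  move=> z; case fz : (f z) => [w| |]; last by have := fNy z.
    (* At [d = z - x] the norm term of [z] vanishes. *)
    rewrite lee_fin -lerBrDr; apply: vE; exists z, w; rewrite fz lexx.
    by split=> //; rewrite subrKC subrr normr0 mulr0 addr0.
  by rewrite leey.
Qed.

Lemma linear_bounded_above_eq0 (R : realFieldType) (V : lmodType R)
    (w : V -> R^o) (M : R) : linear w -> (forall x, w x <= M) -> forall x, w x = 0.
Proof.
move=> wlin wM x; apply: (@scaled_bounded_eq0 _ _ M) => t.
pose wL := GRing.isLinear.Build R V R^o *:%R w wlin.
pose W : {linear V -> R^o} := HB.pack w wL.
by rewrite -[t * w x]/(t *: W x) -linearZ wM.
Qed.

Theorem proposition2 (R : realType) (X : completeNormedModType R)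
    (dimX : dim_ge X 2) (f : X -> \bar R) (fC : proper_convex_lsc X f) :
  continuous_affine X f <->
  exists! u : X -> R^o,
    dual X u /\ exists alpha : R, affine_minorants f (affine_fun u alpha).
Proof.
split=> [[u [alpha [udual ->]]]|[u [[udual [alpha [_ uf]]] uuniq]]].
  exists u; split=> [|v [[vlin _] [beta [_ vu]]]].
    by split=> //; exists alpha; split=> //; exists u, alpha.
  have ulin := udual.1.
  have wlin : linear ((fun x => v x - u x) : X -> R^o).
    by move=> a x y; rewrite vlin ulin scalerBr opprD addrACA.
  apply/funext => x; apply/eqP; rewrite eq_sym -subr_eq0; apply/eqP.
  apply: (@linear_bounded_above_eq0 _ _ _ (alpha - beta) wlin) => y.
  by have := vu y; rewrite lee_fin; lra.
have gap x c : (c%:E < f x)%E -> forall z, ((u z - u x + c)%:E <= f z)%E.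
  move=> cfx z.
  have [v [vdual vf]] := affine_minorant_near_value _ _ _ _ _ _ _ fC udual uf cfx.
  have vB y : v (y - x) = v y - v x.
    by have := vdual.1 (- 1) x y; rewrite !scaleN1r ![- _ + _]addrC.
  suff -> : u = v by rewrite -vB.
  apply: uuniq; split=> //; exists (c - v x); split.
    by exists v, (c - v x).
  by move=> y; have := vf y; rewrite vB /affine_fun addrAC addrA.
have [fNy [x0 fx0] _ _] := fC.
have fx0E : f x0 = (fine (f x0))%:E.
  by rewrite fineK // fin_numE; apply/andP; split; apply/eqP.
exists u, (fine (f x0) - u x0); split=> //; apply/funext => x.
(* [gap] based at [x] and read at [x0] bounds [f x] above, hence [f x] is finite; exchanging [x] and
   [x0] then gives the reverse inequality. *)
have le_fx : (f x <= (u x + (fine (f x0) - u x0))%:E)%E.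
  apply: ereal_le_of_lower_reals => c /gap /(_ x0).
  by rewrite fx0E lee_fin /=; lra.
have [w fxE _] := fin_value_of_le _ _ _ (fNy x) le_fx.
apply/eqP; rewrite eq_le le_fx /= fxE lee_fin.
suff : (f x0 <= (w - u x + u x0)%:E)%E by rewrite fx0E lee_fin /=; lra.
apply: ereal_le_of_lower_reals => c /gap /(_ x).
by rewrite fxE lee_fin; lra.
Qed.
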